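(* Let $d\ge1$ and let $\{S_n\}_{n\ge0}$ be a $d$-symmetric sequence of monic type II multiple orthogonal polynomials, satisfying $$xS_{n+d}(x)=S_{n+d+1}(x)+\gamma_{n+1}S_n(x),\quad \gamma_{n+1}\neq0,\ n\ge0,\qquad S_n(x)=x^n\ \text{ for } 0\le n\le d.$$ Let $\{A_n^j\}_{n\ge0}$, $j=1,\dots,d+1$, be the sequences of polynomials given by $$S_{(d+1)n+j-1}(x)=x^{j-1}A_n^{j}(x^{d+1}),\qquad j=1,\dots,d+1,\ n\ge0.$$ Then, for each $j=1,\dots,d+1$, there are complex coefficients such that $\{A_n^j\}$ satisfies the $(d+2)$-term recurrence relation $$xA_{n+d}^{j}(x)=A_{n+d+1}^{j}(x)+b_{n+d}^{[j]}A_{n+d}^{j}(x)+\sum_{\nu=0}^{d-1}c_{n+d-\nu}^{d-1-\nu,[j]}A_{n+d-1-\nu}^{j}(x),\qquad n\ge0,$$ with $c_{n+1}^{0,[j]}\neq0$ for $n\ge0$, and with initial conditions $A_0^j(x)=1$, $A_1^j(x)=x-b_0^{[j]}$, $$A_n^j(x)=(x-b_{n-1}^{[j]})A_{n-1}^j(x)-\sum_{\nu=0}^{n-2}c_{n-1-\nu}^{d-1-\nu,[j]}A_{n-2-\nu}^j(x),\qquad 2\le n\le d;$$ and therefore each $\{A_n^j\}_{n\ge0}$ is a sequence of type II multiple orthogonal polynomials.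
   Context: Polynomials have complex coefficients; $\mathbb{P}$ denotes the space of all of them. Type II multiple orthogonality: diagonal multi-indices are the elements of $\mathcal{I}=\{(0,\dots,0),(1,0,\dots,0),\dots,(1,\dots,1),(2,1,\dots,1),\dots,(2,\dots,2),\dots\}\subset\mathbb{N}^d$; there is exactly one of each length $n=n_1+\dots+n_d$. A sequence of monic polynomials $\{P_n\}_{n\ge0}$ with $\deg P_n=n$ is type II multiple orthogonal (also called $d$-orthogonal) with respect to linear functionals $u^1,\dots,u^d:\mathbb{P}\to\mathbb{C}$ if for each $n$, with $(n_1,\dots,n_d)\in\mathcal{I}$ of length $n$, $u^j(x^kP_n)=0$ for $k=0,\dots,n_j-1$, $j=1,\dots,d$; the system $\{u^1,\dots,u^d\}$ is required to be regular, i.e. for each $n$ every nonzero polynomial of degree at most $n$ satisfying these conditions has degree exactly $n$. ''A sequence of type II multiple orthogonal polynomials'' means: with respect to some regular system of $d$ functionals. A monic sequence $\{S_n\}$ is $d$-symmetric if $S_n(\xi_kx)=\xi_k^nS_n(x)$ for all $n\ge0$, $k=1,\dots,d$, where $\xi_k=\exp(2k\pi i/(d+1))$. It is a known fact that for a type II multiple orthogonal sequence this is equivalent to satisfying the two-term-right-hand-side recurrence displayed in the claim. *)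

(* Defs.v *)
From mathcomp Require Export all_boot all_order all_algebra.
From mathcomp Require Export complex reals trigo.

Set Implicit Arguments.
Unset Strict Implicit.
Unset Printing Implicit Defensive.

Import GRing.Theory.
Local Open Scope ring_scope.
Local Open Scope complex_scope.

(* The multi-indices (m+1, ..., m+1, m, ..., m), with k < d entries equal to
   m+1; the components 1, ..., d are numbered from 0 by 'I_d. *)
Definition diagonal_multiindex (d : nat) (nu : 'I_d -> nat) : Prop :=
  exists m k : nat,
    (k < d)%N /\ forall j : 'I_d, nu j = (if (j < k)%N then m.+1 else m).

Definition multiindex_length (d : nat) (nu : 'I_d -> nat) : nat :=
  (\sum_(j < d) nu j)%N.

Section MultipleOrthogonality.
Variable R : realType.

Definition monic_sequence (P : nat -> {poly R[i]}) : Prop :=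
  forall n : nat, P n \is monic /\ size (P n) = n.+1.

Definition orthogonality_conditions (d : nat)
    (u : 'I_d -> {scalar {poly R[i]}}) (nu : 'I_d -> nat)
    (p : {poly R[i]}) : Prop :=
  forall (j : 'I_d) (k : nat), (k < nu j)%N -> u j ('X^k * p) = 0.

Definition regular_system (d : nat)
    (u : 'I_d -> {scalar {poly R[i]}}) : Prop :=
  forall (n : nat) (nu : 'I_d -> nat),
    diagonal_multiindex nu -> multiindex_length nu = n ->
    forall p : {poly R[i]},
      p != 0 -> (size p <= n.+1)%N -> orthogonality_conditions u nu p ->
      size p = n.+1.

Definition type2_orthogonal_wrt (d : nat)
    (u : 'I_d -> {scalar {poly R[i]}}) (P : nat -> {poly R[i]}) : Prop :=
  forall (n : nat) (nu : 'I_d -> nat),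
    diagonal_multiindex nu -> multiindex_length nu = n ->
    orthogonality_conditions u nu (P n).

Definition type2_multiple_orthogonal (d : nat)
    (P : nat -> {poly R[i]}) : Prop :=
  monic_sequence P /\
  exists u : 'I_d -> {scalar {poly R[i]}},
    regular_system u /\ type2_orthogonal_wrt u P.

(* exp (2 k pi i / (d + 1)) *)
Definition xi (d k : nat) : R[i] :=
  let t : R := 2 * k%:R * pi / d.+1%:R in cos t +i* sin t.

Definition d_symmetric (d : nat) (S : nat -> {poly R[i]}) : Prop :=
  forall n k : nat, (1 <= k <= d)%N ->
    forall x : R[i], (S n).[xi d k * x] = xi d k ^+ n * (S n).[x].

End MultipleOrthogonality.

(* Main.v *)
(** Iterating [x S_m = S_(m+1) + gamma S_(m-d)] exactly [d+1] times, a path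
   with [k] steps [-d] ends at [m + (d+1) (1-k)], so multiplication by [x^(d+1)]
   stays in one residue class modulo [d+1]; this is the recurrence of [A^j].
   The coefficient of its last term comes from the unique path going down at
   every step, hence is a product of nonzero gammas.  Orthogonality is a
   Favard-type argument: with [u^j] dual to [A_j] ([j < d]), the recurrence makes
   the array [u^(i mod d) (x^(i div d) A_n)] vanish for [i < n], and it does
   not vanish for [i = n]. *)
From HB Require Import structures.
Require Import Defs.
From mathcomp Require Import zify ring.
Import GRing.Theory.
Set Implicit Arguments.
Unset Strict Implicit.
Unset Printing Implicit Defensive.
Local Open Scope ring_scope.
Local Open Scope complex_scope.

(** * Linear functionals given by their moments *)

Section MomentFunctional.
Variables (K : fieldType) (mu : nat -> K).

Definition moment_functional (p : {poly K}) : K := \sum_(i < size p) p`_i * mu i.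

Lemma moment_functional_widen (p : {poly K}) (n : nat) :
  (size p <= n)%N -> moment_functional p = \sum_(i < n) p`_i * mu i.
Proof.
move=> le_pn; rewrite /moment_functional (big_ord_widen n (fun i => p`_i * mu i)) //.
rewrite big_mkcond; apply: eq_bigr => i _.
by case: ltnP => // /(nth_default 0) ->; rewrite mul0r.
Qed.

Lemma moment_functional_is_linear : linear_for *%R moment_functional.
Proof.
move=> a p q; pose n := maxn (size (a *: p + q)) (maxn (size p) (size q)).
rewrite !(@moment_functional_widen _ n) ?leq_max ?leqnn ?orbT //.
rewrite mulr_sumr -big_split; apply: eq_bigr => i _ /=.
by rewrite coefD coefZ; ring.
Qed.

HB.instance Definition _ :=
  GRing.isLinear.Build K {poly K} K *%R moment_functional moment_functional_is_linear.

End MomentFunctional.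

(** * Monic bases, and their dual functionals under a recurrence *)

Section MonicSequence.
Variables (K : fieldType) (A : nat -> {poly K}).
Hypothesis A_monic : forall n, A n \is monic.
Hypothesis size_A : forall n, size (A n) = n.+1.

Lemma monic_sequence_lead (n : nat) : (A n)`_n = 1.
Proof. by move/monicP: (A_monic n); rewrite lead_coefE size_A. Qed.

(** As [A n] is monic of degree n, prescribing [L (A n)] fixes the n-th moment in terms of the
    earlier ones. *)
Lemma monic_sequence_functional (v : nat -> K) :
  exists L : {scalar {poly K}}, forall n, L (A n) = v n.
Proof.
pose next n s := v n - \sum_(i < n) (A n)`_i * s`_i.
(* Course-of-values recursion: [prefix n] lists the first n moments, from which [next] computes the
   following one. *)
pose fix prefix n := if n is m.+1 then rcons (prefix m) (next m (prefix m)) else [::].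
have size_prefix n : size (prefix n) = n by elim: n => //= n; rewrite size_rcons => ->.
pose mu n := next n (prefix n).
have prefixE n i : (i < n)%N -> (prefix n)`_i = mu i.
  elim: n => // n IHn; rewrite ltnS leq_eqVlt /= nth_rcons size_prefix.
  by case/predU1P => [->|lt_in]; rewrite ?ltnn ?eqxx // lt_in IHn.
exists (moment_functional mu) => n /=.
rewrite (@moment_functional_widen _ _ _ n.+1) ?size_A // big_ord_recr /=.
rewrite monic_sequence_lead mul1r [X in _ + X]/mu /next.
under [X in _ - X]eq_bigr => i _ do rewrite prefixE //.
by rewrite addrC subrK.
Qed.

Lemma monic_sequence_span (n : nat) (p : {poly K}) :
  (size p <= n)%N -> exists a : nat -> K, p = \sum_(i < n) a i *: A i.
Proof.
elim: n p => [|n IHn] p le_pn.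
  by exists (fun=> 0); rewrite big_ord0; apply/eqP; rewrite -size_poly_leq0.
have /IHn[a def_p] : (size (p - p`_n *: A n)%R <= n)%N.
  apply/leq_sizeP => i; rewrite leq_eqVlt coefB coefZ.
  case/predU1P => [<-|lt_ni]; first by rewrite monic_sequence_lead mulr1 subrr.
  rewrite (nth_default _ (leq_trans le_pn lt_ni)) [(A n)`_i]nth_default ?size_A //.
  by rewrite mulr0 subrr.
exists (fun i => if (i < n)%N then a i else p`_n).
rewrite big_ord_recr /= ltnn -[LHS](subrK (p`_n *: A n)) def_p; congr (_ + _).
by apply: eq_bigr => i _; rewrite ltn_ord.
Qed.

Variables (d : nat) (h : nat -> nat -> K).
Hypothesis h_last : forall n, (d <= n)%N -> h n d != 0.
Hypothesis recA : forall n, 'X * A n = A n.+1 + \sum_(i < d.+1) h n i *: A (n - i)%N.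

Section DualFunctional.
Variables (j : nat) (u : {scalar {poly K}}).
Hypothesis uA : forall n, u (A n) = (n == j)%:R.

Lemma functional_XnS (k n : nat) :
  u ('X^(k.+1) * A n) =
    u ('X^k * A n.+1) + \sum_(i < d.+1) h n i * u ('X^k * A (n - i)%N).
Proof.
rewrite exprSr -mulrA recA mulrDr linearD mulr_sumr linear_sum; congr (_ + _).
by apply: eq_bigr => i _; rewrite -scalerAr linearZ.
Qed.

(** Each factor X lowers the index by at most [d], so the expansion of ['X^k * A n] only meets [A m]
    with [m > j], where [u] vanishes. *)
Lemma functional_Xn_eq0 (k n : nat) : (d * k + j < n)%N -> u ('X^k * A n) = 0.
Proof.
elim: k n => [|k IHk] n lt_n; first by rewrite expr0 mul1r uA; case: eqP => //; lia.
rewrite functional_XnS IHk ?add0r; last by lia.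
by rewrite big1 // => i _; rewrite IHk ?mulr0 //; have := ltn_ord i; lia.
Qed.

(** In this boundary case only the lowest term of each expansion survives, and its coefficient is
    nonzero by [h_last]. *)
Lemma functional_Xn_neq0 (k : nat) : u ('X^k * A (d * k + j)%N) != 0.
Proof.
elim: k => [|k IHk]; first by rewrite muln0 expr0 mul1r uA eqxx oner_neq0.
rewrite functional_XnS functional_Xn_eq0 ?add0r; last by lia.
rewrite big_ord_recr big1 /= ?add0r => [|i _]; last first.
  by rewrite functional_Xn_eq0 ?mulr0 //; have := ltn_ord i; lia.
rewrite mulf_neq0 ?h_last //; first by lia.
by have -> : (d * k.+1 + j - d = d * k + j)%N by lia.
Qed.

End DualFunctional.

(** The matrix of the [D i (A m)] is triangular with nonzero diagonal, so the coordinates of [p] in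
    the basis [A] vanish one after another. *)
Lemma triangular_pairing_inj (D : nat -> {scalar {poly K}}) (n : nat) (p : {poly K}) :
  (forall i m, (i < m)%N -> D i (A m) = 0) -> (forall i, D i (A i) != 0) ->
  (size p <= n)%N -> (forall i, (i < n)%N -> D i p = 0) -> p = 0.
Proof.
move=> DA0 DA1 /monic_sequence_span[a ->] Dp0.
suffices a0 i : (i < n)%N -> a i = 0.
  by rewrite big1 // => i _; rewrite a0 ?scale0r.
elim/ltn_ind: i => i IHi lt_in.
have := Dp0 i lt_in; rewrite linear_sum (bigD1 (Ordinal lt_in)) //= big1 ?addr0.
  by rewrite linearZ => /eqP; rewrite mulf_eq0 (negPf (DA1 i)) orbF => /eqP.
move=> m; rewrite -val_eqE neq_ltn linearZ /= => /orP[lt_mi | lt_im].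
  by rewrite (IHi m lt_mi (ltn_ord m)) mul0r.
by rewrite DA0 ?mulr0.
Qed.

End MonicSequence.

(** * Diagonal multi-indices and the Favard-type theorem *)

Lemma diagonal_multiindexP (d : nat) (nu : 'I_d -> nat) (n : nat) :
  diagonal_multiindex nu -> multiindex_length nu = n ->
  forall (j : 'I_d) (k : nat), (k < nu j)%N = (d * k + j < n)%N.
Proof.
case=> m [r [lt_rd nuE]] <- j k.
(* [m] full rounds through the [d] components, then [r] more conditions: when the pair (j, k) is
   numbered d k + j, the multi-index selects an initial segment. *)
have -> : multiindex_length nu = (d * m + r)%N.
  rewrite /multiindex_length (eq_bigr (fun i : 'I_d => m + (i < r))%N) => [|i _]; last first.
    by rewrite nuE; case: ifP => _ /=; lia.
  rewrite big_split /= sum_nat_const card_ord; congr (_ + _)%N.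
  rewrite -{2}(card_ord r) -sum1_card (big_ord_widen d (fun=> 1%N) (ltnW lt_rd)).
  by rewrite [RHS]big_mkcond; apply: eq_bigr => i _; case: ltnP.
have lt_jd := ltn_ord j; rewrite nuE.
case: (ltngtP k m) => [lt_km|lt_mk|->].
- have : (d * k.+1 <= d * m)%N by rewrite leq_mul.
  by case: ifP; lia.
- have : (d * m.+1 <= d * k)%N by rewrite leq_mul.
  by case: ifP; lia.
- by rewrite ltn_add2l; case: ifP; lia.
Qed.

Lemma type2_orthogonal_favard (R : realType) (d : nat) (A : nat -> {poly R[i]})
    (h : nat -> nat -> R[i]) :
  (0 < d)%N -> monic_sequence A ->
  (forall n, (d <= n)%N -> h n d != 0) ->
  (forall n, 'X * A n = A n.+1 + \sum_(i < d.+1) h n i *: A (n - i)%N) ->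
  type2_multiple_orthogonal d A.
Proof.
move=> d_gt0 monA h_last recA; split=> //.
have A_monic n : A n \is monic by case: (monA n).
have size_A n : size (A n) = n.+1 by case: (monA n).
have dual j : exists L : {scalar {poly R[i]}}, forall n, L (A n) = (n == j)%:R.
  exact: (monic_sequence_functional A_monic size_A (fun n => (n == j)%:R)).
have [u uA] := boolp.choice dual.
exists (fun j : 'I_d => u j); split=> [n nu diag_nu len_nu p p_neq0 le_pn p_orth | ]; last first.
  move=> n nu diag_nu len_nu j k; rewrite (diagonal_multiindexP diag_nu len_nu).
  exact: (functional_Xn_eq0 recA (uA j)).
(* Were the degree below n, [p] would lie in the span of the first n of the [A i] and be killed by
   the first n of the [D i] below, hence be zero. *)
apply/eqP; rewrite eqn_leq le_pn ltnNge; apply: contra p_neq0 => le_pn'.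
have lin_D i : linear_for *%R (fun q => u (i %% d)%N ('X^(i %/ d) * q)).
  by move=> a q r; rewrite mulrDr -scalerAr linearP.
pose D i : {scalar {poly R[i]}} :=
  HB.pack (fun q => u (i %% d)%N ('X^(i %/ d) * q))
    (GRing.isLinear.Build _ _ _ _ _ (lin_D i)).
have div_d i : (d * (i %/ d) + i %% d = i)%N by rewrite mulnC -divn_eq.
apply/eqP/(@triangular_pairing_inj _ A A_monic size_A D n) => // [i m lt_im|i|i lt_in] /=.
- by apply: (functional_Xn_eq0 recA (uA _)); rewrite div_d.
- by have := functional_Xn_neq0 h_last recA (uA (i %% d)%N) (i %/ d); rewrite div_d.
- have lt_mod : (i %% d < d)%N by rewrite ltn_mod.
  apply: (p_orth (Ordinal lt_mod)).
  by rewrite (diagonal_multiindexP diag_nu len_nu) div_d.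
Qed.

(** * The iterated recurrence as a sum over paths *)

Section PathWeights.
Variables (K : fieldType) (d : nat) (gamma : nat -> K).

(* Total weight of the paths with [p] steps starting at [m], [k] of them
   going from some [l >= d] to [l - d] and the others from [l] to [l + 1]. *)
Fixpoint path_weight (p m k : nat) : K :=
  if p is q.+1 then
    path_weight q m.+1 k +
    (if (d <= m)%N && (0 < k)%N then gamma (m - d).+1 * path_weight q (m - d) k.-1 else 0)
  else (k == 0%N)%:R.

Lemma path_weight0 (p m : nat) : path_weight p m 0 = 1.
Proof. by elim: p m => //= p IHp m; rewrite IHp andbF addr0. Qed.

Lemma path_weight_many (p m k : nat) : (p < k)%N -> path_weight p m k = 0.
Proof.
elim: p m k => [|p IHp] m k /=; first by case: k.
by move=> lt_pk; rewrite !IHp ?mulr0 ?if_same ?addr0 //; lia.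
Qed.

(** Such a path would end at the negative index m + p - k(d+1), but down steps only start from
    indices at least [d]. *)
Lemma path_weight_low (p m k : nat) : (m + p < k * d.+1)%N -> path_weight p m k = 0.
Proof.
elim: p m k => [|p IHp] m k /=; first by case: k.
move=> lt_k; rewrite IHp ?add0r; last by lia.
by case: ifP => // /andP[le_dm k_gt0]; rewrite IHp ?mulr0 //; case: k k_gt0 lt_k => //= k; lia.
Qed.

Lemma path_weight_down (p m : nat) :
  (forall n, gamma n.+1 != 0) -> (p * d <= m)%N -> path_weight p m p != 0.
Proof.
move=> gamma_neq0; elim: p m => [|p IHp] m le_m /=; first exact: oner_neq0.
rewrite path_weight_many // add0r andbT ifT; last by lia.
by rewrite mulf_neq0 ?IHp //; lia.
Qed.

(** Induction on [p], splitting off the first step. Where the subtraction truncates,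
    [path_weight_low] makes the weight zero. *)
Lemma mulXn_path_weight (S : nat -> {poly K}) :
  (forall n, 'X * S (n + d)%N = S (n + d).+1 + gamma n.+1 *: S n) ->
  (forall n, (n <= d)%N -> S n = 'X^n) ->
  forall p m, 'X^p * S m = \sum_(k < p.+1) path_weight p m k *: S (m + p - k * d.+1)%N.
Proof.
move=> recS initS; elim=> [|p IHp] m.
  by rewrite big_ord1 mul1r scale1r mul0n subn0 addn0.
(* Below [d] there is no down step: [S m] and [S m.+1] are monomials. *)
have stepS : 'X * S m = S m.+1 + (if (d <= m)%N then gamma (m - d).+1 *: S (m - d)%N else 0).
  case: leqP => [le_dm | lt_md]; first by rewrite -{1 2}(subnK le_dm) recS.
  by rewrite !initS ?addr0 -?exprS // ltnW.
rewrite exprSr -mulrA stepS mulrDr IHp /=.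
under [RHS]eq_bigr => k _ do rewrite scalerDl.
(* The extreme terms drop: p + 1 down steps do not fit in p steps, and a path starting with a down
   step has k > 0. *)
rewrite big_split /= [X in _ = X + _]big_ord_recr /= path_weight_many // scale0r addr0.
rewrite [X in _ = _ + X]big_ord_recl /= andbF scale0r add0r.
congr (_ + _); first by apply: eq_bigr => k _; rewrite addSnnS.
case: leqP => [le_dm | lt_md]; last by rewrite mulr0 big1 // => k _; rewrite scale0r.
rewrite -scalerAr IHp scaler_sumr; apply: eq_bigr => k _.
by rewrite scalerA /=; congr (_ *: S _); rewrite /bump /=; lia.
Qed.

End PathWeights.

(** * The components and their recurrence *)

Section Components.
Variables (K : fieldType) (d j : nat) (S A : nat -> {poly K}) (gamma : nat -> K).
Hypothesis le_jd : (j <= d)%N.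
Hypothesis recS : forall n, 'X * S (n + d)%N = S (n + d).+1 + gamma n.+1 *: S n.
Hypothesis gamma_neq0 : forall n, gamma n.+1 != 0.
Hypothesis initS : forall n, (n <= d)%N -> S n = 'X^n.
Hypothesis S_A : forall n, S (d.+1 * n + j)%N = 'X^j * (A n \Po 'X^(d.+1)).

(** With i + 1 down steps out of d + 1, a path leads from (d+1)n + j to (d+1)(n-i) + j; the path
    without down steps yields [A n.+1]. *)
Definition component_coef (n i : nat) : K :=
  path_weight d gamma d.+1 (d.+1 * n + j) i.+1.

(** As [j <= d], the endpoint (d+1)(n-i) + j would be negative. *)
Lemma component_coef_out (n i : nat) : (n < i)%N -> component_coef n i = 0.
Proof.
move=> lt_ni; apply: path_weight_low.
by have : (n.+2 * d.+1 <= i.+1 * d.+1)%N by [rewrite leq_mul]; lia.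
Qed.

Lemma component_coef_last (n : nat) : (d <= n)%N -> component_coef n d != 0.
Proof.
move=> le_dn; apply: path_weight_down => //.
by rewrite (leq_trans _ (leq_addr _ _)) // leq_mul.
Qed.

Lemma component_rec (n : nat) :
  'X * A n = A n.+1 + \sum_(i < d.+1) component_coef n i *: A (n - i)%N.
Proof.
(* Injectivity lets the identity be checked on [S], after substituting X^(d+1) and multiplying by
   X^j. *)
have Xd_inj : injective (fun p : {poly K} => 'X^j * (p \Po 'X^(d.+1))).
  have Xj_neq0 : 'X^j != 0 :> {poly K} by rewrite monic_neq0 ?monicXn.
  move=> p q /(mulfI Xj_neq0) /eqP; rewrite -subr_eq0 -comp_polyB.
  by rewrite comp_poly_eq0 ?size_polyXn // subr_eq0 => /eqP.
apply: Xd_inj; rewrite /= comp_polyM comp_polyX mulrCA -S_A.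
rewrite (mulXn_path_weight recS initS) big_ord_recl path_weight0 scale1r.
rewrite comp_polyD mulrDr -S_A; congr (S _ + _).
  by rewrite /= mul0n; nia.
rewrite raddf_sum mulr_sumr; apply: eq_bigr => i _.
rewrite lift0 [X in _ * X]linearZ -scalerAr -S_A -/(component_coef n i).
(* For i > n the index [n - i] truncates to 0, but the coefficient is zero. *)
case: (leqP i n) => [le_in | lt_ni]; last by rewrite component_coef_out ?scale0r.
congr (_ *: S _); rewrite -{1}(subnK le_in); nia.
Qed.

Lemma component_monic (n : nat) : S (d.+1 * n + j)%N \is monic -> A n \is monic.
Proof.
rewrite S_A monicE lead_coefM lead_coefXn mul1r lead_coef_comp ?size_polyXn //.
by rewrite lead_coefXn expr1n mulr1.
Qed.

Lemma component_size (n : nat) :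
  S (d.+1 * n + j)%N \is monic -> size (S (d.+1 * n + j)%N) = (d.+1 * n + j).+1 ->
  size (A n) = n.+1.
Proof.
move=> /component_monic/monic_neq0 A_neq0.
have sA_gt0 : (0 < size (A n))%N by rewrite size_poly_gt0.
rewrite S_A mulrC size_mulXn; last by rewrite comp_poly_eq0 ?size_polyXn.
have := size_comp_poly (A n) 'X^(d.+1); rewrite size_polyXn /=.
rewrite addnC -addSn => comp_size /addIn S_size; move: comp_size.
rewrite S_size /= mulnC => /eqP; by rewrite eqn_pmul2r // => /eqP {2}->; rewrite prednK.
Qed.

End Components.

(** * Recurrence, initial conditions and orthogonality of each component *)

Theorem theorem4 (R : realType) (d : nat) (S : nat -> {poly R[i]})
    (gamma : nat -> R[i]) (A : nat -> nat -> {poly R[i]}) :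
  (1 <= d)%N ->
  type2_multiple_orthogonal d S ->
  d_symmetric d S ->
  (forall n : nat,
     'X * S (n + d)%N = S (n + d + 1)%N + gamma n.+1 *: S n) ->
  (forall n : nat, gamma n.+1 != 0) ->
  (forall n : nat, (n <= d)%N -> S n = 'X^n) ->
  (forall j n : nat, (1 <= j <= d + 1)%N ->
     S ((d + 1) * n + j - 1)%N = 'X^(j - 1) * (A j n \Po 'X^(d + 1))) ->
  forall j : nat, (1 <= j <= d + 1)%N ->
    (* c m nu stands for the coefficient with lower index m, upper index nu *)
    (exists (b : nat -> R[i]) (c : nat -> nat -> R[i]),
      [/\ forall n : nat,
            'X * A j (n + d)%N =
              A j (n + d + 1)%N + b (n + d)%N *: A j (n + d)%N
              + \sum_(0 <= nu < d)
                  c (n + d - nu)%N (d - 1 - nu)%N *: A j (n + d - 1 - nu)%N,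
          forall n : nat, c n.+1 0%N != 0,
          A j 0%N = 1,
          A j 1%N = 'X - (b 0%N)%:P
        & forall n : nat, (2 <= n <= d)%N ->
            A j n =
              ('X - (b (n - 1)%N)%:P) * A j (n - 1)%N
              - \sum_(0 <= nu < n - 1)
                  c (n - 1 - nu)%N (d - 1 - nu)%N *: A j (n - 2 - nu)%N])
    /\ type2_multiple_orthogonal d (A j).

Proof.
(* Components are numbered from 1 in the claim; from here on [j] is one less, the exponent of x. *)
move=> d_gt0 [monS _] _ recS gamma_neq0 initS S_A [//|j] /andP[_]; rewrite addn1 ltnS => le_jd.
have recS' n : 'X * S (n + d)%N = S (n + d).+1 + gamma n.+1 *: S n by rewrite recS addn1.
have S_A' n : S (d.+1 * n + j)%N = 'X^j * (A j.+1 n \Po 'X^(d.+1)).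
  by have := S_A j.+1 n; rewrite addn1 addnS !subn1; apply.
have monA : monic_sequence (A j.+1).
  move=> n; have [monS_n sizeS_n] := monS (d.+1 * n + j)%N.
  by split; [exact: component_monic S_A' _ monS_n | exact: component_size S_A' _ monS_n sizeS_n].
pose h := component_coef d j gamma.
have h_out n i : (n < i)%N -> h n i = 0 by exact: component_coef_out.
have h_last n : (d <= n)%N -> h n d != 0 by exact: component_coef_last.
have recA n : 'X * A j.+1 n = A j.+1 n.+1 + \sum_(i < d.+1) h n i *: A j.+1 (n - i)%N.
  exact: component_rec le_jd recS' initS S_A' n.
split; last exact: type2_orthogonal_favard recA.
have A0 : A j.+1 0%N = 1.
  have [monA0 sizeA0] := monA 0%N.
  by rewrite (size1_polyC (eq_leq sizeA0)); move/monicP: monA0; rewrite lead_coefE sizeA0 => ->.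
have recA' n : 'X * A j.+1 n = A j.+1 n.+1 + h n 0%N *: A j.+1 n
    + \sum_(0 <= nu < d) h n nu.+1 *: A j.+1 (n - 1 - nu)%N.
  rewrite recA big_ord_recl subn0 addrA big_mkord; congr (_ + _).
  by apply: eq_bigr => i _; rewrite lift0 -subnDA add1n.
(* Solved from [c (n - nu) (d - 1 - nu) = h n nu.+1] for nu < d and nu <= n; in particular
   [c n.+1 0] is [h (n + d) d]. *)
exists (fun n => h n 0%N), (fun m k => h (m + (d - 1 - k))%N (d - k)%N); split=> //.
- move=> n; rewrite recA' addn1; congr (_ + _).
  apply: eq_big_nat => nu /andP[_ lt_nu]; congr (h _ _ *: A _ _); lia.
- by move=> n; rewrite !subn0; apply: h_last; lia.
- have := recA' 0%N; rewrite A0 mulr1 big1 ?addr0 => [-> | nu _]; last by rewrite h_out ?scale0r.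
  by rewrite alg_polyC addrK.
- case=> [|n] // /andP[n_gt0 le_nd]; rewrite subn1 /= mulrBl recA' mul_polyC.
  (* The terms with nu >= n vanish by [h_out], which leaves the shorter sum of the initial
     conditions. *)
  rewrite (@big_cat_nat _ _ _ n 0 d) //=; last by lia.
  have -> : \sum_(n <= nu < d) h n nu.+1 *: A j.+1 (n - 1 - nu)%N = 0.
    by rewrite big_nat big1 // => nu /andP[le_nu _]; rewrite h_out ?scale0r.
  rewrite addr0 [A j.+1 n.+1 + _ + _]addrAC addrK -[LHS](addrK (\sum_(0 <= nu < n) h n nu.+1 *: A j.+1 (n - 1 - nu)%N)).
  congr (_ - _); apply: eq_big_nat => nu /andP[_ lt_nu]; congr (h _ _ *: A _ _); lia.
Qed.
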